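(* Let $p$ be an odd prime and $\mathbf{k}$ a field of characteristic $p$. Suppose that the Steenrod operations $\mathcal{P}^i$ ($i\ge 0$) act on $\mathcal{E}_\infty(p)$ in such a way that the Cartan formula and unstable conditions hold. Then for every homogeneous element $x$ of the subring spanned by the monomials not involving any of the $\xi_i$, we have $\mathcal{P}^m(x)=x^p$ and $\mathcal{P}^i(x)=0$ for $i\ne m$, where $|x|=2m$.
   Context: $R(n,p)=\mathbf{k}[x_1,\dots,x_n]\otimes\Lambda(\xi_1,\dots,\xi_n)$ is the $\mathbb{Z}[\frac1p]$-graded (graded commutative) algebra with polynomial generators of degree $|x_i|=\frac{2(p^i-1)}{p^i}$ and exterior generators of degree $|\xi_i|=\frac{p^i-2}{p^i}$. $\mathcal{E}_n(p)$ is its $\mathbb{Z}$-graded subalgebra consisting of the homogeneous components of integer degree. The inclusions $\mathcal{E}_{n-1}(p)\to\mathcal{E}_n(p)$ send each generator to the one of the same name, and $\mathcal{E}_\infty(p)=\varinjlim_n\mathcal{E}_n(p)$. Homogeneous elements of the subring of $\mathcal{E}_\infty(p)$ spanned by monomials in the $x_i$ alone have even integer degree. An action of the Steenrod operations here consists of additive maps $\mathcal{P}^i\colon\mathcal{E}_\infty(p)_d\to\mathcal{E}_\infty(p)_{d+2i(p-1)}$, $i\ge 0$; it is not assumed that $\mathcal{P}^0$ is the identity. The Cartan formula is $\mathcal{P}^r(xy)=\sum_{i+j=r}\mathcal{P}^i(x)\mathcal{P}^j(y)$. The unstable conditions are $\mathcal{P}^i(x)=x^p$ if $2i=|x|$ and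 $\mathcal{P}^i(x)=0$ if $2i>|x|$. *)

(* Defs.v *)
From HB Require Import structures.
From mathcomp Require Import all_boot all_order all_algebra.
From mathcomp Require Import finmap.
From mathcomp Require Export monalg.

Set Implicit Arguments.
Unset Strict Implicit.
Unset Printing Implicit Defensive.

Import GRing.Theory Num.Theory.

Local Open Scope fset_scope.
Local Open Scope ring_scope.

(* The exterior A-algebra on generators xi_0, xi_1, ... indexed by nat.  It is
   the free A-module on finite sets S of indices, where << S >> stands for the
   product of the xi_i, i in S, taken in increasing order of i. *)
Section Exterior.
Variable A : comNzRingType.

Definition extalg := {malg A[{fset nat}]}.

HB.instance Definition _ := GRing.Lmodule.on extalg.

Definition inversions (S T : {fset nat}) : nat :=
  (\sum_(i <- S) \sum_(j <- T) (j < i))%N.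

(* << S >> * << T >> = ext_sign S T *: << S `|` T >>: sorting the factors costs
   one sign per inversion, and a repeated factor gives 0. *)
Definition ext_sign (S T : {fset nat}) : A :=
  if fdisjoint S T then (-1) ^+ inversions S T else 0.

Definition extmul (f g : extalg) : extalg :=
  \sum_(S <- msupp f) \sum_(T <- msupp g)
    << f@_S * g@_T * ext_sign S T *g S `|` T >>.

Definition extone : extalg := << 1 *g fset0 >>.

Lemma extmulw (d1 d2 : {fset {fset nat}}) f g :
  msupp f `<=` d1 -> msupp g `<=` d2 ->
  extmul f g = \sum_(S <- d1) \sum_(T <- d2)
    << f@_S * g@_T * ext_sign S T *g S `|` T >>.
Proof.
move=> le_d1 le_d2; rewrite /extmul (big_fset_incl _ le_d1) /=.
  apply/eq_bigr => S _; apply/big_fset_incl => // T _ /mcoeff_outdom ->.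
  by rewrite mulr0 mul0r monalgU0.
move=> S _ /mcoeff_outdom fS.
by rewrite big1 // => T _; rewrite fS !mul0r monalgU0.
Qed.

Lemma extmulDl : left_distributive extmul +%R.
Proof.
move=> f1 f2 g.
rewrite [in RHS](extmulw (fsubsetUl _ (msupp f2)) (fsubset_refl _)).
rewrite [in RHS](extmulw (fsubsetUr (msupp f1) _) (fsubset_refl _)).
rewrite (extmulw (msuppD_le _ _) (fsubset_refl _)).
rewrite -big_split /=; apply/eq_bigr => S _.
rewrite -big_split /=; apply/eq_bigr => T _.
by rewrite mcoeffD !mulrDl monalgUD.
Qed.

Lemma extmulDr : right_distributive extmul +%R.
Proof.
move=> g f1 f2.
rewrite [in RHS](extmulw (fsubset_refl _) (fsubsetUl _ (msupp f2))).
rewrite [in RHS](extmulw (fsubset_refl _) (fsubsetUr (msupp f1) _)).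
rewrite (extmulw (fsubset_refl _) (msuppD_le _ _)).
rewrite -big_split /=; apply/eq_bigr => S _.
rewrite -big_split /=; apply/eq_bigr => T _.
by rewrite mcoeffD mulrDr mulrDl monalgUD.
Qed.

Lemma extmul0l : left_zero 0 extmul.
Proof. by move=> g; rewrite /extmul msupp0 big_seq_fset0. Qed.

Lemma extmul0r : right_zero 0 extmul.
Proof.
by move=> g; rewrite /extmul big1 // => S _; rewrite msupp0 big_seq_fset0.
Qed.

Lemma extmulUU a b S T :
  extmul << a *g S >> << b *g T >> = << a * b * ext_sign S T *g S `|` T >>.
Proof.
by rewrite (extmulw msuppU_le msuppU_le) !big_seq_fset1 !mcoeffUU.
Qed.

Lemma ext_sign0l S : ext_sign fset0 S = 1.
Proof. by rewrite /ext_sign fdisjoint0X /inversions big_seq_fset0 expr0. Qed.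

Lemma ext_sign0r S : ext_sign S fset0 = 1.
Proof.
rewrite /ext_sign fdisjointX0 /inversions big1 ?expr0 // => i _.
by rewrite big_seq_fset0.
Qed.

Lemma perm_fsetU (S T : {fset nat}) :
  fdisjoint S T -> perm_eq (S `|` T) (S ++ T).
Proof.
move=> dST; apply: uniq_perm; rewrite ?fset_uniq //.
  rewrite cat_uniq !fset_uniq andbT /=; apply/hasPn => i iT.
  by apply/negP => iS; case/negP: (fdisjointP dST i iS).
by move=> i; rewrite mem_cat in_fsetU.
Qed.

Lemma inversionsUl (S T U : {fset nat}) : fdisjoint S T ->
  inversions (S `|` T) U = (inversions S U + inversions T U)%N.
Proof.
by move=> dST; rewrite /inversions (perm_big _ (perm_fsetU dST)) big_cat.
Qed.

Lemma inversionsUr (S T U : {fset nat}) : fdisjoint T U ->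
  inversions S (T `|` U) = (inversions S T + inversions S U)%N.
Proof.
move=> dTU; rewrite /inversions -big_split /=.
by apply: eq_bigr => i _; rewrite (perm_big _ (perm_fsetU dTU)) big_cat.
Qed.

Lemma ext_signA S T U :
  ext_sign T U * ext_sign S (T `|` U) = ext_sign S T * ext_sign (S `|` T) U.
Proof.
rewrite /ext_sign fdisjointUX fdisjointXU.
have [dST|_] /= := boolP (fdisjoint S T); last by rewrite mulr0 mul0r.
have [dTU|_] /= := boolP (fdisjoint T U); last by rewrite andbF mulr0 mul0r.
have [dSU|_] /= := boolP (fdisjoint S U); last by rewrite !mulr0.
rewrite inversionsUl // inversionsUr // -!exprD.
by congr (_ ^+ _); rewrite addnC addnA.
Qed.

Lemma extmul1l : left_id extone extmul.
Proof.
move=> g; rewrite (extmulw msuppU_le (fsubset_refl _)) big_seq_fset1.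
rewrite [RHS]monalgE; apply/eq_bigr => T _.
by rewrite mcoeffUU mul1r ext_sign0l mulr1 fset0U.
Qed.

Lemma extmul1r : right_id extone extmul.
Proof.
move=> g; rewrite (extmulw (fsubset_refl _) msuppU_le).
rewrite [RHS]monalgE; apply/eq_bigr => T _.
by rewrite big_seq_fset1 mcoeffUU mulr1 ext_sign0r mulr1 fsetU0.
Qed.

Lemma extmulA : associative extmul.
Proof.
move=> f g h; rewrite (monalgE f) (monalgE g) (monalgE h).
have suml I r (F : I -> extalg) (z : extalg) :
    extmul (\sum_(i <- r) F i) z = \sum_(i <- r) extmul (F i) z.
  exact: (big_morph (extmul^~ z) (fun _ _ => extmulDl _ _ _) (extmul0l _)).
have sumr I r (F : I -> extalg) (z : extalg) :
    extmul z (\sum_(i <- r) F i) = \sum_(i <- r) extmul z (F i).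
  exact: (big_morph (extmul z) (fun _ _ => extmulDr _ _ _) (extmul0r _)).
have mulUU := extmulUU; move: extmul suml sumr mulUU => mul suml sumr mulUU.
rewrite !suml; apply: eq_bigr => S _.
rewrite [LHS]sumr [X in _ = mul X _]sumr suml; apply: eq_bigr => T _.
rewrite !sumr; apply: eq_bigr => U _.
rewrite !mulUU fsetUA; congr (<< _ *g _ >>).
rewrite mulrA -[LHS]mulrA ext_signA mulrA [_ * (_ * h@_U)]mulrA.
by congr (_ * _); rewrite mulrAC.
Qed.

Lemma extone_neq0 : extone != 0.
Proof. by rewrite monalgU_eq0 oner_eq0. Qed.

HB.instance Definition _ := GRing.Zmodule_isNzRing.Build extalg
  extmulA extmul1l extmul1r extmulDl extmulDr extone_neq0.

Lemma extalg_scaleAl (a : A) (f g : extalg) : a *: (f * g) = a *: f * g.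
Proof.
have aE (h : extalg) : a *: h = extmul << a *g fset0 >> h.
  apply/malgP => S; rewrite mcoeffZ.
  rewrite (extmulw msuppU_le (fsubset_refl _)) big_seq_fset1 {1}(monalgE h).
  rewrite !raddf_sum mulr_sumr; apply/eq_bigr => T _ /=.
  by rewrite mcoeffUU ext_sign0l mulr1 fset0U !mcoeffU mulrnAr.
by rewrite !aE; exact: extmulA.
Qed.

HB.instance Definition _ :=
  GRing.Lmodule_isLalgebra.Build A extalg extalg_scaleAl.

Definition xi (i : nat) : extalg := << 1 *g [fset i] >>.

Lemma xi_anticomm i j : xi i * xi j = - (xi j * xi i).
Proof.
rewrite /xi /GRing.mul /= !extmulUU fsetUC -monalgUN; congr (<< _ *g _ >>).
rewrite !mul1r /ext_sign /inversions !big_seq_fset1 !fdisjoint1X !in_fset1.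
have [->|neq_ij] := eqVneq i j; first by rewrite oppr0.
by case: ltngtP neq_ij => //= _ _; rewrite ?expr0 ?expr1 ?opprK.
Qed.

Lemma xi_sqr i : xi i ^+ 2 = 0.
Proof.
rewrite expr2 /xi /GRing.mul /= !extmulUU /ext_sign fdisjoint1X in_fset1 eqxx.
by rewrite mulr0 monalgU0.
Qed.

End Exterior.

(* k[x_1, x_2, ...] (x) Lambda(xi_1, xi_2, ...), as the exterior algebra over
   the polynomial ring.  Indices are shifted: i : nat stands for x_(i+1), xi_(i+1). *)
Definition Rinf (k : fieldType) := extalg {malg k[{cmonom nat}]}.

HB.instance Definition _ (k : fieldType) := GRing.Lalgebra.on (Rinf k).

Section Grading.
Variables (p : nat) (k : fieldType).
Implicit Types (x : Rinf k) (m : {cmonom nat}) (S : {fset nat}).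

Definition x_deg (i : nat) : rat := 2 * (p%:R ^+ i - 1) / p%:R ^+ i.
Definition xi_deg (i : nat) : rat := (p%:R ^+ i - 2) / p%:R ^+ i.

(* (m, S) encodes prod_i x_(i+1) ^ (m i) * prod_(i in S) xi_(i+1);
   its coefficient in x is (x@_S)@_m. *)
Definition occurs m S x : Prop := m \in msupp x@_S.

Definition monom_deg m S : rat :=
  \sum_(i <- finsupp m) x_deg i.+1 *+ m i + \sum_(i <- S) xi_deg i.+1.

Definition homogeneous (d : rat) x : Prop :=
  forall m S, occurs m S x -> monom_deg m S = d.

(* R(n,p), as the subalgebra of Rinf on the first n generators of each kind. *)
Definition in_R (n : nat) x : Prop :=
  forall m S, occurs m S x ->
    (forall i, i \in finsupp m -> (i < n)%N) /\
    (forall i, i \in S -> (i < n)%N).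

Definition in_E (n : nat) x : Prop :=
  in_R n x /\ forall m S, occurs m S x -> monom_deg m S \is a Num.int.

(* The transition maps are inclusions of subalgebras of Rinf, so their direct
   limit is the union. *)
Definition in_Einf x : Prop := exists n, in_E n x.

Definition in_Einf_deg (d : int) x : Prop := in_Einf x /\ homogeneous d%:~R x.

Definition in_Einf_poly x : Prop :=
  in_Einf x /\ forall m S, occurs m S x -> S = fset0.

(* Only the values of P i on homogeneous elements of E_oo matter: a family of
   additive maps indexed by the degree is the same as one map, as distinct
   degrees share only the element 0. *)
Definition steenrod_action (P : nat -> Rinf k -> Rinf k) : Prop :=
  (forall i d x, in_Einf_deg d x ->
     in_Einf_deg (d + (2 * i * (p - 1))%N%:Z) (P i x)) /\
  (forall i d x y, in_Einf_deg d x -> in_Einf_deg d y ->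
     P i (x + y) = P i x + P i y).

Definition cartan_formula (P : nat -> Rinf k -> Rinf k) : Prop :=
  forall r d e x y, in_Einf_deg d x -> in_Einf_deg e y ->
    P r (x * y) = \sum_(i < r.+1) P i x * P (r - i)%N y.

Definition unstable_conditions (P : nat -> Rinf k -> Rinf k) : Prop :=
  forall i d x, in_Einf_deg d x ->
    ((2 * i)%N%:Z = d -> P i x = x ^+ p) /\
    (d < (2 * i)%N%:Z -> P i x = 0).

Lemma in_EW n x : in_E n x -> in_E n.+1 x.
Proof.
move=> [Rx Ex]; split=> // m S /Rx[hm hS].
by split=> i => [/hm|/hS] /ltnW.
Qed.

Lemma Einf_poly_deg_even (d : int) x :
    prime p -> odd p -> in_Einf_poly x -> in_Einf_deg d x -> x != 0 ->
  exists m : nat, d = (2 * m)%N%:Z.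
Proof.
move=> p_pr p_odd [[n [Rx _]] polyx] [_ homx] nz_x.
have [S nz_S] : exists S, x@_S != 0.
  have [x0|[S xS]] := fset_0Vmem (msupp x).
    by case/eqP: nz_x; rewrite (monalgE x) x0 big_seq_fset0.
  by exists S; rewrite mcoeff_neq0.
have [m mxS] : exists m, occurs m S x.
  have [x0|[m mxS]] := fset_0Vmem (msupp x@_S); last by exists m.
  by case/eqP: nz_S; rewrite (monalgE x@_S) x0 big_seq_fset0.
have S0 := polyx _ _ mxS; have [ltn _] := Rx _ _ mxS.
have := homx _ _ mxS; rewrite /monom_deg S0 big_seq_fset0 addr0 => degE.
have p_gt0 := prime_gt0 p_pr.
have nz_p e : (p%:R ^+ e : rat) != 0 by rewrite expf_neq0 // pnatr_eq0 -lt0n.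
pose N := (\sum_(i <- finsupp m) m i * ((p ^ i.+1 - 1) * p ^ (n - i.+1)))%N.
have dE : d * (p ^ n)%N%:Z = (2 * N)%N%:Z.
  apply: (@intr_inj rat); rewrite rmorphM /= -degE -!pmulrn.
  rewrite natrM natr_sum mulr_sumr mulr_suml big_seq [RHS]big_seq.
  apply: eq_bigr => i /ltn lt_in; rewrite !natrM natrB ?expn_gt0 ?p_gt0 //.
  rewrite -{1}(subnKC lt_in) expnD natrM !natrX /x_deg -[_ / _ *+ _]mulr_natr.
  by rewrite mulrACA divfK ?nz_p // -[LHS]mulrA; congr (_ * _); rewrite mulrCA.
have pn_gt0 : (0 < p ^ n)%N by rewrite expn_gt0 p_gt0.
have d_ge0 : 0 <= d.
  by have := pmulr_lge0 d (_ : 0 < (p ^ n)%N%:Z); rewrite dE => <-;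
     rewrite ?ltz_nat.
case: d dE d_ge0 {degE homx} => // d dE _.
have {}dE : (d * p ^ n = 2 * N)%N by apply/eqP; rewrite -eqz_nat PoszM dE.
exists d./2; rewrite mul2n; congr Posz; apply/esym/even_halfK.
have := congr1 odd dE; rewrite mul2n odd_double oddM oddX p_odd orbT andbT.
by move=> ->.
Qed.

End Grading.

(* Main.v *)
(* Let d be half the degree of a monomial x, and put D_i(x) = P^(d-i)(x), so that
   D_0(x) = x^p. By the Cartan formula phi(x) = sum_i P^i(x) s^i is
   multiplicative, and it has degree at most d in s.

   Modulo the exterior generators, take u_n = x_n^q with q = p^n, and
   z = x_n^(q-1) x_(n+1)^p, so that z^q = u_n^(q-1) u_(n+1). In characteristic p
   the q top coefficients of a q-th power vanish except for the leading one, and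
   comparing the top coefficients of phi(u_n)^q phi(u_(n+1)) = phi(z)^q phi(u_n)
   shows that x_n^(pq) divides D_i(u_n) for all i > 0. This is impossible for
   degree reasons unless D_i(u_n) = 0. Any monomial x of even degree has a power
   x^(p^N) that is a product of u_n's; as the polynomial ring is reduced, phi(x)
   is a monomial in s.

   There remain the terms with exterior generators. By induction on i > 0, D_i is
   a derivation along the Frobenius map, so it kills p-th powers, and the
   divisibility argument gives D_i(u_n) = 0 and, for v = x_n x_N^(p^N - p^(N-n))
   and N > n, that D_i(v) is divisible by v^p / x_n^p. This leaves an exterior part
   of degree less than 2, but a nonempty set of exterior generators occurring in
   degree divisible by 2(p-1) has at least 2(p-1) elements and degree more
   than 2. The monomials u_n and v generate all the monomials of even degree. *)
Require Import Defs.
From mathcomp Require Import all_boot all_order all_algebra.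
From mathcomp Require Import finmap ring lra zify.
Set Implicit Arguments.
Unset Strict Implicit.
Unset Printing Implicit Defensive.
Import Order.TTheory GRing.Theory Num.Theory.
Local Open Scope fset_scope.
Local Open Scope ring_scope.

Local Notation "m ^^ n" := (expcmn m n) (at level 29, left associativity).
Local Notation "''U_' i" := (ucm i) (at level 8, i at level 2, format "''U_' i").

(** * Monomial algebras in characteristic p *)

Lemma expcmnE (I : choiceType) (m : {cmonom I}) n i : (m ^^ n) i = (m i * n)%N.
Proof.
rewrite /expcmn; elim: n => [|[|n] IHn]; rewrite ?cm1 ?muln0 ?muln1 //.
by rewrite mulnS -IHn -mulcmE.
Qed.

Lemma expcmnS (I : choiceType) (m : {cmonom I}) n : m ^^ n.+1 = mmul m (m ^^ n).
Proof. by apply/eqP/cmP => i; rewrite cmM !expcmnE mulnS. Qed.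

Lemma expcmn0 (I : choiceType) (m : {cmonom I}) : m ^^ 0 = mone.
Proof. by []. Qed.

Section MonomialAlgebra.
Context (I : choiceType) (R : comNzRingType).
Implicit Types (m : {cmonom I}) (f g : {malg R[{cmonom I}]}).

Lemma mmulI m : injective (mmul m).
Proof.
move=> m1 m2 /eqP/cmP eq_mm; apply/eqP/cmP => i.
by have := eq_mm i; rewrite !cmM => /addnI.
Qed.

Lemma malgUM m1 m2 : << mmul m1 m2 >> = << m1 >> * << m2 >> :> {malg R[{cmonom I}]}.
Proof. by rewrite malgM_def fgmulUU mulr1. Qed.

Lemma malgUX c m n :
  << c ^+ n *g m ^^ n >> = << c *g m >> ^+ n :> {malg R[{cmonom I}]}.
Proof.
elim: n => [|n IHn]; rewrite ?expcmn0 ?expr0 // expcmnS !exprS -IHn.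
by rewrite malgM_def fgmulUU.
Qed.

Lemma mcoeffUM m a f : (<< m >> * f)@_(mmul m a) = f@_a.
Proof.
rewrite malgM_def fgmulUg raddf_sum /= [in RHS](monalgE f) raddf_sum /=.
by apply: eq_bigr => b _; rewrite !mcoeffU mul1r (inj_eq (@mmulI m)).
Qed.

Lemma malgU_mulI m : injective ( *%R (<< m >> : {malg R[{cmonom I}]})).
Proof.
by move=> f g eq_fg; apply/malgP => a; rewrite -(mcoeffUM m) eq_fg mcoeffUM.
Qed.

(** Divisibility phrased through exponents: the product of [m1] and [a] occurs on the left, hence on
    the right, so it is a multiple of [m2]. *)
Lemma msupp_eqUM m1 m2 f g a : << m1 >> * f = << m2 >> * g -> a \in msupp f ->
  forall i, (m2 i <= m1 i + a i)%N.
Proof.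
move=> eq_fg af i.
have : mmul m1 a \in msupp (<< m2 >> * g).
  by rewrite -eq_fg -mcoeff_neq0 mcoeffUM mcoeff_neq0.
case/msuppM_le => b [c []]; rewrite msuppU1 in_fset1 => /eqP -> _.
by move/eqP/cmP/(_ i); rewrite !cmM => ->; rewrite leq_addr.
Qed.

End MonomialAlgebra.

(** * Powers with exponent q = p^n *)

Section FrobeniusPower.
Context (R : comNzRingType) (p : nat) (charRp : p \in [pchar R]).

Lemma exprD_pcharX (x y : R) n : (x + y) ^+ (p ^ n) = x ^+ (p ^ n) + y ^+ (p ^ n).
Proof.
by apply: exprDn_pchar; rewrite pnatX (pnatE _ (pcharf_prime charRp)) charRp.
Qed.

Lemma expr_sum_pcharX J (r : seq J) (F : J -> R) n :
  (\sum_(j <- r) F j) ^+ (p ^ n) = \sum_(j <- r) F j ^+ (p ^ n).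
Proof.
apply: (big_morph (fun x : R => x ^+ (p ^ n))) => [x y|]; first exact: exprD_pcharX.
by rewrite expr0n expn_eq0 eqn0Ngt (prime_gt0 (pcharf_prime charRp)).
Qed.

End FrobeniusPower.

(** Frobenius is additive, so the q-th power of sum f_i s^i is sum f_i^q s^(qi), where q = p^n. *)
Lemma coef_pcharX (R : comNzRingType) p n (f : {poly R}) j : p \in [pchar R] ->
  (f ^+ (p ^ n))`_j = if (p ^ n %| j)%N then f`_(j %/ p ^ n) ^+ (p ^ n) else 0.
Proof.
move=> charRp; have p_gt0 := prime_gt0 (pcharf_prime charRp).
have q_gt0 : (0 < p ^ n)%N by rewrite expn_gt0 p_gt0.
have charPp : p \in [pchar {poly R}] by apply: rmorph_pchar charRp; apply: polyC.
elim/poly_ind: f j => [|f c IHf] j.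
  by rewrite expr0n eqn0Ngt q_gt0 !coef0 expr0n eqn0Ngt q_gt0 if_same.
rewrite exprD_pcharX // exprMn -polyC_exp coefD coefMXn coefC IHf.
rewrite coefD coefMX coefC.
have [lt_jq|le_qj] := ltnP j (p ^ n).
  rewrite divn_small // !add0r.
  by case: j lt_jq => [|j] lt_jq; rewrite ?dvdn0 // gtnNdvd.
rewrite -[in RHS](subnK le_qj) dvdn_addl // divnDr // divnn q_gt0 addn1 /=.
by rewrite gtn_eqF ?(leq_trans q_gt0) //= !addr0.
Qed.

(** Raising monomials to the power q = p^n is injective, so the coefficient of a^q in f^q is the
    q-th power of that of a in f. *)
Lemma malg_reduced (I : choiceType) (R : idomainType) p n
    (f : {malg R[{cmonom I}]}) :
  p \in [pchar R] -> f ^+ (p ^ n) = 0 -> f = 0.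
Proof.
move=> charRp fX0; have p_gt0 := prime_gt0 (pcharf_prime charRp).
have q_gt0 : (0 < p ^ n)%N by rewrite expn_gt0 p_gt0.
have charAp : p \in [pchar {malg R[{cmonom I}]}].
  by apply: rmorph_pchar charRp; apply: (@malgC {cmonom I} R).
apply/malgP => a; rewrite mcoeff0; apply/eqP.
have /negP : ~ (f@_a != 0); last by rewrite negbK.
move=> nz_fa; move/malgP/(_ (a ^^ (p ^ n))): fX0.
rewrite {1}(monalgE f) expr_sum_pcharX // raddf_sum /=.
have q_inj b : (b ^^ (p ^ n) == a ^^ (p ^ n)) = (b == a).
  apply/cmP/eqP => [eq_ab|-> //]; apply/eqP/cmP => i; have := eq_ab i.
  by rewrite !expcmnE => /eqP; rewrite eqn_pmul2r // => /eqP.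
rewrite (big_fsetD1 a) /=; last by rewrite -mcoeff_neq0.
rewrite big1_fset ?addr0 => [|b]; last first.
  rewrite in_fsetD1 => /andP[neq_ba _] _.
  by rewrite -malgUX mcoeffU q_inj (negbTE neq_ba).
rewrite -malgUX mcoeffU eqxx mcoeff0.
by move/eqP; rewrite expf_eq0 (negbTE nz_fa) andbF.
Qed.

(* In top degrees, f^q with q a power of the characteristic looks like its
   leading term: the next one is q degrees lower. *)
Lemma coef_pcharXM_top (R : comNzRingType) p n (f g : {poly R}) a b t :
  p \in [pchar R] -> (size f <= a.+1)%N -> (size g <= b.+1)%N ->
  (t < p ^ n)%N -> (t <= b)%N ->
  (f ^+ (p ^ n) * g)`_(p ^ n * a + (b - t)) = f`_a ^+ (p ^ n) * g`_(b - t).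
Proof.
move=> charRp sz_f sz_g lt_tq le_tb; rewrite coefM.
have q_gt0 : (0 < p ^ n)%N by apply: leq_ltn_trans lt_tq.
have lt_i : (p ^ n * a < (p ^ n * a + (b - t)).+1)%N by rewrite ltnS leq_addr.
rewrite (bigD1 (Ordinal lt_i)) //= coef_pcharX // dvdn_mulr // mulKn //.
rewrite addKn big1 ?addr0 // => i neq_i; rewrite coef_pcharX //.
case: ifP => [/dvdnP[c def_i]|_]; last by rewrite mul0r.
(* With q = p^n, for c < a the index of [g] is at least b + q - t > b; for c > a the coefficient of
   [f] vanishes. *)
rewrite def_i mulnK //; have [lt_ca|le_ac] := ltnP c a.
  rewrite [g`__]nth_default ?mulr0 //; apply: leq_trans sz_g _.
  have : (c.+1 * p ^ n <= a * p ^ n)%N by rewrite leq_mul2r lt_ca orbT.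
  by rewrite mulSn; move: (p ^ n)%N lt_tq {neq_i def_i lt_i q_gt0} => q; nia.
have lt_ac : (a < c)%N.
  rewrite ltn_neqAle le_ac andbT; apply: contraNneq neq_i => eq_ac.
  by apply/eqP/val_inj; rewrite /= def_i eq_ac mulnC.
rewrite nth_default ?(leq_trans sz_f) // expr0n eqn0Ngt q_gt0 mul0r //.
Qed.

(** With q = p^n, multiplying the relation by f gives f^q g = h^q f. Both sides are read off in
    degree q a + (b - t) = q e + (a - t), where only the leading term of the q-th power
    contributes. *)
Lemma coef_top_pcharX (R : comNzRingType) p n (f g h : {poly R})
    (F G H : nat -> R) a b e t :
  p \in [pchar R] ->
  (forall i, f`_i = F i) -> (forall i, g`_i = G i) -> (forall i, h`_i = H i) ->
  (size f <= a.+1)%N -> (size g <= b.+1)%N -> (size h <= e.+1)%N ->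
  f ^+ (p ^ n - 1) * g = h ^+ (p ^ n) ->
  ((p ^ n - 1) * a + b = p ^ n * e)%N ->
  (t < p ^ n)%N -> (t <= a)%N -> (t <= b)%N ->
  F a ^+ (p ^ n) * G (b - t)%N = H e ^+ (p ^ n) * F (a - t)%N.
Proof.
move=> charRp fE gE hE szf szg szh eq_fgh eq_abe lt_tq le_ta le_tb.
have q_gt0 : (0 < p ^ n)%N by apply: leq_ltn_trans lt_tq.
rewrite -!fE -gE -hE.
rewrite -(coef_pcharXM_top charRp szf szg) // -(coef_pcharXM_top charRp szh szf) //.
have -> : (p ^ n * a + (b - t) = p ^ n * e + (a - t))%N.
  rewrite -eq_abe !addnBA //; congr (_ - _)%N.
  by rewrite addnAC mulnBl mul1n subnK // leq_pmull.
by rewrite -eq_fgh mulrAC -exprSr -subSn // subn1.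
Qed.

(** * Coefficients and degrees *)

Section ExteriorCoefficients.
Context (A : comNzRingType).
Implicit Types (a : A) (x y : extalg A) (S : {fset nat}).

Lemma mcoeff_extmul (D1 D2 : {fset {fset nat}}) x y S :
  msupp x `<=` D1 -> msupp y `<=` D2 ->
  (x * y)@_S = \sum_(T <- D1) \sum_(U <- D2)
    (x@_T * y@_U * ext_sign A T U) *+ (T `|` U == S).
Proof.
move=> le1 le2; rewrite -[LHS]/((extmul x y)@_S) (extmulw le1 le2) raddf_sum.
apply: eq_bigr => T _; rewrite raddf_sum; apply: eq_bigr => U _.
exact: mcoeffU.
Qed.

Lemma mcoeff_constl a x S : ((<< a *g fset0 >> : extalg A) * x)@_S = a * x@_S.
Proof.
rewrite (mcoeff_extmul _ msuppU_le (fsubset_refl _)) big_seq_fset1.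
rewrite [in RHS](monalgE x) [in RHS]raddf_sum mulr_sumr /=; apply: eq_bigr => T _.
by rewrite mcoeffUU ext_sign0l mulr1 fset0U [in RHS]mcoeffU mulrnAr.
Qed.

Lemma mcoeff_constr a x S : (x * (<< a *g fset0 >> : extalg A))@_S = a * x@_S.
Proof.
rewrite (mcoeff_extmul _ (fsubset_refl _) msuppU_le).
rewrite [in RHS](monalgE x) [in RHS]raddf_sum mulr_sumr /=; apply: eq_bigr => T _.
rewrite big_seq_fset1 mcoeffUU ext_sign0r mulr1 fsetU0.
by rewrite [in RHS]mcoeffU mulrnAr mulrC.
Qed.

(** A union is empty only if both sets are, so reduction modulo the exterior generators is
    multiplicative. *)
Lemma mcoeffM_fset0 x y : (x * y)@_fset0 = x@_fset0 * y@_fset0.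
Proof.
rewrite (mcoeff_extmul _ (fsubsetUl _ [fset fset0]) (fsubsetUl _ [fset fset0])).
rewrite (big_fsetD1 fset0) /= ?in_fsetU ?in_fset1 ?eqxx ?orbT //.
rewrite (big_fsetD1 fset0) /= ?in_fsetU ?in_fset1 ?eqxx ?orbT //.
rewrite fsetU0 eqxx ext_sign0l mulr1 mulr1n !big1_fset ?addr0 // => S.
  rewrite in_fsetD1 => /andP[nz_S _] _; rewrite big1 // => T _.
  by rewrite fsetU_eq0 (negbTE nz_S).
by rewrite in_fsetD1 => /andP[nz_S _] _; rewrite fset0U (negbTE nz_S).
Qed.

Lemma constM a b :
  << a * b *g fset0 >> = (<< a *g fset0 >> : extalg A) * << b *g fset0 >>.
Proof. rewrite -[RHS]/(extmul << a *g fset0 >> << b *g fset0 >>).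
by rewrite extmulUU ext_sign0l mulr1 fset0U. Qed.

End ExteriorCoefficients.

Section Monomials.
Context (k : fieldType).
Implicit Types (x y : Rinf k) (m a : {cmonom nat}) (S : {fset nat}).

Definition polyring : comNzRingType := {malg k[{cmonom nat}]}.
Implicit Types f g : polyring.

Definition support f : {fset {cmonom nat}} := msupp f.
Definition coefx S x : polyring := x@_S.

(* Opaque, because unification must not unfold monomials. *)
Fact pmon_exists : {f : {cmonom nat} -> polyring | forall m, f m = << 1 *g m >>}.
Proof. by exists (fun m => << 1 *g m >>). Qed.

Fact mon_exists :
  {f : {cmonom nat} -> Rinf k | forall m, f m = << << 1 *g m >> *g fset0 >>}.
Proof. by exists (fun m => << << 1 *g m >> *g fset0 >>). Qed.

Definition pmon := sval pmon_exists.
Definition mon := sval mon_exists.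

Lemma pmonE m : pmon m = << 1 *g m >>. Proof. exact: svalP pmon_exists m. Qed.

Lemma monE m : mon m = << << 1 *g m >> *g fset0 >>.
Proof. exact: svalP mon_exists m. Qed.

Lemma pmonM m1 m2 : pmon (mmul m1 m2) = pmon m1 * pmon m2.
Proof. rewrite !pmonE; exact: malgUM. Qed.

Lemma pmon1 : pmon mone = 1.
Proof. exact: pmonE. Qed.

Lemma pmonX m n : pmon (m ^^ n) = pmon m ^+ n.
Proof.
elim: n => [|n IHn]; first by rewrite expcmn0 pmon1 expr0.
by rewrite expcmnS pmonM IHn exprS.
Qed.

Lemma pmon_mulI m : injective ( *%R (pmon m)).
Proof. rewrite pmonE; exact: malgU_mulI. Qed.

Lemma support_pmonM m1 m2 f g a : pmon m1 * f = pmon m2 * g -> a \in support f ->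
  forall i, (m2 i <= m1 i + a i)%N.
Proof. rewrite !pmonE; exact: msupp_eqUM. Qed.

Lemma support_eq0 f : (forall a, a \notin support f) -> f = 0.
Proof.
by move=> f0; apply/malgP => a; rewrite mcoeff0; apply/eqP; rewrite mcoeff_eq0 f0.
Qed.

Lemma pchar_polyring p : p \in [pchar k] -> p \in [pchar polyring].
Proof. exact: (rmorph_pchar (@malgC {cmonom nat} k)). Qed.

Lemma polyring_reduced p n f : p \in [pchar k] -> f ^+ (p ^ n) = 0 -> f = 0.
Proof. exact: malg_reduced. Qed.

Lemma coefx0 S : coefx S 0 = 0. Proof. exact: mcoeff0. Qed.

Lemma coefxD S : {morph coefx S : x y / x + y}. Proof. exact: mcoeffD. Qed.

Lemma coefx_eq0 x : (forall S, coefx S x = 0) -> x = 0.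
Proof. by move=> x0; apply/malgP => S; rewrite mcoeff0; exact: x0. Qed.

Lemma coefx_sum S J (r : seq J) (F : J -> Rinf k) :
  coefx S (\sum_(j <- r) F j) = \sum_(j <- r) coefx S (F j).
Proof. exact: (big_morph _ (coefxD S) (coefx0 S)). Qed.

Lemma coefxM_fset0 x y : coefx fset0 (x * y) = coefx fset0 x * coefx fset0 y.
Proof. exact: mcoeffM_fset0. Qed.

Lemma coefx_monl m x S : coefx S (mon m * x) = pmon m * coefx S x.
Proof. rewrite monE pmonE; exact: mcoeff_constl. Qed.

Lemma coefx_monr m x S : coefx S (x * mon m) = pmon m * coefx S x.
Proof. rewrite monE pmonE; exact: mcoeff_constr. Qed.

Lemma coefx_mon0 m : coefx fset0 (mon m) = pmon m.
Proof. rewrite monE pmonE; exact: mcoeffUU. Qed.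

Lemma monM m1 m2 : mon (mmul m1 m2) = mon m1 * mon m2.
Proof. rewrite !monE malgUM; exact: constM. Qed.

Lemma mon1 : mon mone = 1.
Proof. exact: monE. Qed.

Lemma monX m n : mon (m ^^ n) = mon m ^+ n.
Proof.
elim: n => [|n IHn]; first by rewrite expcmn0 expr0 mon1.
by rewrite expcmnS monM IHn exprS.
Qed.

Lemma occurs_mon m S m' : occurs m S (mon m') -> m = m' /\ S = fset0.
Proof.
rewrite /occurs monE mcoeffU; case: eqP => [<-|_].
  by rewrite mulr1n msuppU1 in_fset1 => /eqP.
by rewrite mulr0n msupp0 in_fset0.
Qed.

Lemma occursD m S x y : occurs m S (x + y) -> occurs m S x \/ occurs m S y.
Proof.
rewrite /occurs mcoeffD => /(fsubsetP (msuppD_le _ _)).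
by rewrite in_fsetU => /orP.
Qed.

End Monomials.

(** * Degrees of monomials and of their exterior parts *)

Section Weights.
Context (p : nat).
Context (p_pr : prime p) (p_odd : odd p).
Implicit Types (m a : {cmonom nat}) (S : {fset nat}).

Let p_gt2 : (2 < p)%N. Proof. exact: odd_prime_gt2. Qed.
Let p_gt0 : (0 < p)%N. Proof. exact: prime_gt0. Qed.

Let nz_p e : (p ^ e)%:R != 0 :> rat.
Proof. by rewrite pnatr_eq0 -lt0n expn_gt0 p_gt0. Qed.

Lemma x_degE i : x_deg p i = 2 - 2 / (p ^ i)%:R.
Proof. by rewrite /x_deg -natrX; field; exact: nz_p. Qed.

Lemma xi_degE i : xi_deg p i = 1 - 2 / (p ^ i)%:R.
Proof. by rewrite /xi_deg -natrX; field; exact: nz_p. Qed.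

Lemma x_degS_gt0 i : 0 < x_deg p i.+1.
Proof.
rewrite x_degE subr_gt0 ltr_pdivrMr ?ltr0n ?expn_gt0 ?p_gt0 //.
rewrite -natrM ltr_nat -[X in (X < _)%N]muln1 ltn_mul2l /=.
by rewrite -{1}(expn0 p) ltn_exp2l // (leq_trans _ p_gt2).
Qed.

Lemma monom_degEw m S (D : {fset nat}) : finsupp m `<=` D ->
  monom_deg p m S =
    \sum_(i <- D) x_deg p i.+1 *+ m i + \sum_(i <- S) xi_deg p i.+1.
Proof.
move=> sub_mD; congr (_ + _); rewrite (big_fset_incl _ sub_mD) //= => i _.
by rewrite -cmE_eq0 => /eqP->; rewrite mulr0n.
Qed.

Lemma monom_degM m1 m2 S :
  monom_deg p (mmul m1 m2) S = monom_deg p m1 fset0 + monom_deg p m2 S.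
Proof.
have sub1 : finsupp m1 `<=` finsupp (mmul m1 m2) by rewrite mdomD fsubsetUl.
have sub2 : finsupp m2 `<=` finsupp (mmul m1 m2) by rewrite mdomD fsubsetUr.
rewrite (monom_degEw _ sub1) (monom_degEw _ sub2) big_seq_fset0 addr0 addrA.
congr (_ + _); rewrite -big_split /=; apply: eq_bigr => i _.
by rewrite cmM mulrnDr.
Qed.

Lemma monom_deg1 : monom_deg p mone fset0 = 0.
Proof. by rewrite /monom_deg mdom1 !big_seq_fset0 addr0. Qed.

Lemma monom_degU i : monom_deg p 'U_i fset0 = x_deg p i.+1.
Proof. by rewrite /monom_deg mdomU big_seq_fset1 big_seq_fset0 cmUU addr0. Qed.

Lemma monom_degX m n : monom_deg p (m ^^ n) fset0 = monom_deg p m fset0 *+ n.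
Proof.
elim: n => [|n IHn]; first by rewrite monom_deg1.
by rewrite expcmnS monom_degM IHn mulrS.
Qed.

Lemma monom_deg_ge a S c i : (c <= a i)%N ->
  x_deg p i.+1 *+ c + \sum_(j <- S) xi_deg p j.+1 <= monom_deg p a S.
Proof.
move=> le_ca; rewrite (monom_degEw _ (fsubsetUl _ [fset i])) lerD2r.
rewrite (big_fsetD1 i) /=; last by rewrite in_fsetU in_fset1 eqxx orbT.
apply: (@le_trans _ _ (x_deg p i.+1 *+ a i)).
  by rewrite ler_wpMn2l // ltW // x_degS_gt0.
by rewrite lerDl sumr_ge0 // => j _; rewrite mulrn_wge0 // ltW // x_degS_gt0.
Qed.

Lemma xi_degS_gt0 i : 0 < xi_deg p i.+1.
Proof.
rewrite xi_degE subr_gt0 ltr_pdivrMr ?ltr0n ?expn_gt0 ?p_gt0 //.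
rewrite mul1r ltr_nat; apply: leq_trans p_gt2 _.
by rewrite -{1}(expn1 p) leq_exp2l // (leq_trans _ p_gt2).
Qed.

Lemma xi_deg_ge i : 7 / 9 <= xi_deg p i.+2.
Proof.
have le9 : (9 <= p ^ i.+2)%N.
  rewrite (@leq_trans (3 ^ 2)) // (@leq_trans (p ^ 2)) ?leq_exp2r //.
  by rewrite leq_exp2l // (leq_trans _ p_gt2).
have : 2 / (p ^ i.+2)%:R <= 2 / 9%:R :> rat.
  by rewrite ler_pM2l // lef_pV2 ?posrE ?ltr0n ?expn_gt0 ?p_gt0 // ler_nat.
by rewrite xi_degE; move: (_ / (p ^ _)%:R) => e; lra.
Qed.

(* xi_1 may have degree as small as 1/3, the others have degree at least 7/9. *)
Lemma sum_xi_deg_gt2 S : (3 < #|` S|)%N -> 2 < \sum_(i <- S) xi_deg p i.+1.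
Proof.
move=> S_gt3.
have [c [c_ge0 c3_gt2 c_le]] : exists c : rat,
    [/\ 0 <= c, 2 < c *+ 3 & forall i, c <= xi_deg p i.+2].
  by exists (7 / 9); split; [lra | lra | exact: xi_deg_ge].
apply: (@lt_le_trans _ _ (\sum_(i <- S `\ 0%N) c)).
  rewrite big_const_seq count_predT iter_addr_0 (lt_le_trans c3_gt2) //.
  rewrite ler_wpMn2l //; move: S_gt3; rewrite (cardfsD1 0%N S).
  by case: (_ \in _) => //; exact: ltnW.
apply: (@le_trans _ _ (\sum_(i <- S `\ 0%N) xi_deg p i.+1)).
  rewrite big_seq [leRHS]big_seq; apply: ler_sum => i; rewrite in_fsetD1.
  by case/andP => nz_i _; rewrite -(prednK (n := i)) ?lt0n.
have [S0|nS0] := boolP (0%N \in S); last by rewrite mem_fsetD1.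
by rewrite [leRHS](big_fsetD1 _ S0) /= lerDr ltW ?xi_degS_gt0.
Qed.

(* x_i counts as 0 and xi_i as -1 modulo 2 (p - 1), because p^M is 1 modulo
   2 (p - 1) for M even. *)
Lemma dvdn_card_exterior m S c :
  monom_deg p m S = (2 * (p - 1) * c)%:R -> (2 * (p - 1) %| #|` S|)%N.
Proof.
set d := (2 * (p - 1))%N => degE.
have [N ltN] : exists N, forall i, i \in finsupp m `|` S -> (i < N.*2)%N.
  exists (\max_(i <- finsupp m `|` S) i).+1 => i iD.
  have := @leq_bigmax_seq nat _ xpredT id i iD isT.
  by rewrite -ltnS => /leq_trans-> //; rewrite -addnn leq_addl.
(* Multiplying the degree by p^M clears all denominators, and p^M is 1 modulo [d] because M is
   even. *)
pose M := N.*2.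
pose X := (\sum_(i <- finsupp m) (p ^ i.+1 - 1) * p ^ (M - i.+1) * m i)%N.
pose Y := (\sum_(i <- S) (p ^ i.+1 - 2) * p ^ (M - i.+1))%N.
have pow_ge2 i : (2 <= p ^ i.+1)%N.
  by apply: leq_trans (ltnW p_gt2) _; rewrite -{1}(expn1 p) leq_exp2l //; lia.
have powE i : i \in finsupp m `|` S -> (p ^ M = p ^ i.+1 * p ^ (M - i.+1))%N.
  by move=> /ltN lt_iM; rewrite -expnD subnKC.
have eqN : (2 * X + Y = d * c * p ^ M)%N.
  apply/eqP; rewrite -(eqr_nat rat) [eqbRHS]natrM -degE natrD natrM /X /Y !natr_sum.
  rewrite /monom_deg; apply/eqP; rewrite [RHS]mulrDl mulr_sumr !mulr_suml.
  congr (_ + _).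
    rewrite big_seq [RHS]big_seq; apply: eq_bigr => i im.
    rewrite (powE i) ?in_fsetU ?im // x_degE !natrM natrB ?(ltnW (pow_ge2 i)) //.
    by rewrite -mulr_natr; field; exact: nz_p.
  rewrite big_seq [RHS]big_seq; apply: eq_bigr => i iS.
  rewrite (powE i) ?in_fsetU ?iS ?orbT // xi_degE !natrM natrB //.
  by field; exact: nz_p.
have dvd_pow e : (p - 1 %| p ^ e - 1)%N.
  by rewrite -{2}(exp1n e) subn_exp dvdn_mulr.
have dvdX : (d %| 2 * X)%N.
  rewrite dvdn_pmul2l // dvdn_sum // => i _.
  by rewrite -mulnA dvdn_mulr.
have p1_even : (2 %| p - 1)%N by rewrite dvdn2 oddB // p_odd.
have dvdM : (d %| p ^ M - 1)%N.
  rewrite /M -muln2 expnM -{2}(exp1n 2) subn_sqr mulnC dvdn_mul //.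
  by rewrite dvdn2 oddD oddX p_odd orbT.
have dvdYS : (d %| Y + #|` S|)%N.
  rewrite -sum1_size /Y -big_split /= big_seq dvdn_sum // => i iS.
  have := powE i; rewrite in_fsetU iS orbT => /(_ isT) pME.
  have : (d %| 2 * (p ^ (M - i.+1) - 1))%N by rewrite dvdn_pmul2l.
  move=> dvd2; rewrite -(dvdn_addr _ dvd2).
  suff -> : (2 * (p ^ (M - i.+1) - 1) + ((p ^ i.+1 - 2) * p ^ (M - i.+1) + 1) =
             p ^ M - 1)%N by [].
  have v_gt0 : (0 < p ^ (M - i.+1))%N by rewrite expn_gt0 p_gt0.
  have : (2 * p ^ (M - i.+1) <= p ^ i.+1 * p ^ (M - i.+1))%N.
    by rewrite leq_mul2r pow_ge2 orbT.
  rewrite pME mulnBl mulnBr muln1.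
  move: v_gt0; move: (p ^ i.+1 * p ^ (M - i.+1))%N (p ^ (M - i.+1))%N; clear; lia.
move: dvdYS; rewrite dvdn_addr // -(dvdn_addr _ dvdX) eqN -mulnA dvdn_mulr //.
Qed.

End Weights.

(** * Monomials of even degree *)

Section EvenMonomials.
Context (p : nat) (p_pr : prime p).
Implicit Types (m : {cmonom nat}).

Let p_gt0 : (0 < p)%N. Proof. exact: prime_gt0. Qed.
Let p_gt1 : (1 < p)%N. Proof. exact: prime_gt1. Qed.
Let pX_gt0 e : (0 < p ^ e)%N. Proof. by rewrite expn_gt0 p_gt0. Qed.

Let nz_p e : (p ^ e)%:R != 0 :> rat.
Proof. by rewrite pnatr_eq0 -lt0n. Qed.

Let nz_p1 : p%:R != 0 :> rat.
Proof. by rewrite pnatr_eq0 -lt0n. Qed.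

Fact hdeg_exists :
  {h : {cmonom nat} -> nat |
    forall m d, monom_deg p m fset0 = (2 * d)%:R -> h m = d}.
Proof.
exists (fun m => Num.truncn (monom_deg p m fset0 / 2)) => m d ->.
by rewrite natrM mulrAC divff ?pnatr_eq0 // mul1r natrK.
Qed.

(* Half the degree of m; this is a junk value unless even_deg m. *)
Definition hdeg := sval hdeg_exists.
Definition even_deg m : Prop := monom_deg p m fset0 = (2 * hdeg m)%:R.

Lemma hdegP m d : monom_deg p m fset0 = (2 * d)%:R -> even_deg m /\ hdeg m = d.
Proof.
by move=> degE; rewrite /even_deg /hdeg (svalP hdeg_exists _ _ degE).
Qed.

Lemma even_degM m1 m2 : even_deg m1 -> even_deg m2 ->
  even_deg (mmul m1 m2) /\ hdeg (mmul m1 m2) = (hdeg m1 + hdeg m2)%N.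
Proof. by move=> e1 e2; apply: hdegP; rewrite monom_degM e1 e2 mulnDr natrD. Qed.

Lemma even_degX m n : even_deg m ->
  even_deg (m ^^ n) /\ hdeg (m ^^ n) = (n * hdeg m)%N.
Proof.
by move=> em; apply: hdegP; rewrite monom_degX em -mulrnA -mulnA [(n * _)%N]mulnC.
Qed.

Lemma even_deg1 : even_deg mone /\ hdeg mone = 0%N.
Proof. by apply: hdegP; rewrite monom_deg1. Qed.

Lemma monom_degUX n c :
  monom_deg p ('U_n ^^ c) fset0 = (2 - 2 / (p ^ n.+1)%:R) * c%:R.
Proof. by rewrite monom_degX monom_degU x_degE // mulr_natr. Qed.

(* Recall that 'U_n stands for x_(n+1). *)
Definition umon n := 'U_n ^^ (p ^ n.+1).

Lemma even_umon n : even_deg (umon n) /\ hdeg (umon n) = (p ^ n.+1 - 1)%N.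
Proof.
apply: hdegP; rewrite monom_degUX natrM natrB //.
by field; exact: nz_p.
Qed.

(** The q-th root of u_n^(q-1) u_(n+1) for q = p^(n+1), where u_n stands for [umon n]. *)
Definition zmon n := mmul ('U_n ^^ (p ^ n.+1 - 1)) ('U_n.+1 ^^ p).

Lemma even_zmon n : even_deg (zmon n).
Proof.
suff /hdegP[] : monom_deg p (zmon n) fset0 = (2 * (p ^ n.+1 - 1 + (p - 1)))%:R by [].
rewrite monom_degM !monom_degUX natrM natrD !natrB //.
by rewrite (expnS p n.+1) natrM; field; rewrite ?nz_p ?nz_p1.
Qed.

(* With N = n + r + 1 this is x_(n+1) * x_(N+1)^(p^(N+1) - p^(N-n)). Modulo the
   umon's, these monomials generate all the monomials of even degree. *)
Definition vmon n r :=
  mmul 'U_n ('U_(n + r).+1 ^^ (p ^ (n + r).+2 - p ^ r.+1)).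

Lemma leq_pX e1 e2 : (e1 <= e2)%N -> (p ^ e1 <= p ^ e2)%N.
Proof. by rewrite leq_exp2l. Qed.

Lemma even_vmon n r :
  even_deg (vmon n r) /\ hdeg (vmon n r) = (p ^ (n + r).+2 - p ^ r.+1)%N.
Proof.
have le_r : (p ^ r.+1 <= p ^ (n + r).+2)%N by apply: leq_pX; lia.
apply: hdegP; rewrite monom_degM monom_degUX monom_degU x_degE // natrM natrB //.
have -> : (n + r).+2 = (n.+1 + r.+1)%N by rewrite addnS.
by rewrite expnD natrM; field; rewrite !nz_p.
Qed.

(** Chosen so that its p-th power carries [vmon n r] to [vmon n r.+1] up to factors [umon], as
    [vmon_smon] shows. *)
Definition smon n r :=
  mmul ('U_(n + r).+1 ^^ (p ^ r)) ('U_(n + r).+2 ^^ (p ^ (n + r).+3 - p ^ r.+1)).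

Lemma even_smon n r : even_deg (smon n r).
Proof.
have le_r : (p ^ r.+1 <= p ^ (n + r).+3)%N by apply: leq_pX; lia.
suff /hdegP[] : monom_deg p (smon n r) fset0 =
  (2 * (p ^ r + (p ^ (n + r).+3 - p ^ r.+1) - 1))%:R by [].
have le1 : (1 <= p ^ r + (p ^ (n + r).+3 - p ^ r.+1))%N by rewrite ltn_addr.
rewrite monom_degM !monom_degUX natrM (natrB _ le1) natrD (natrB _ le_r).
have -> : (n + r).+3 = (n.+2 + r.+1)%N by lia.
have -> : (n + r).+2 = (n.+2 + r)%N by lia.
rewrite !expnD (expnS p r); move: (nz_p n.+2) (nz_p r).
move: (p ^ n.+2)%N (p ^ r)%N => q s nz_q nz_s.
by rewrite !natrM; field; rewrite nz_q nz_s nz_p1.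
Qed.

Lemma umonE n i : umon n i = ((n == i) * p ^ n.+1)%N.
Proof. by rewrite expcmnE cmU. Qed.

Lemma zmonE n i :
  zmon n i = ((n == i) * (p ^ n.+1 - 1) + (n.+1 == i) * p)%N.
Proof. by rewrite cmM !expcmnE !cmU. Qed.

Lemma vmonE n r i : vmon n r i =
  ((n == i) + ((n + r).+1 == i) * (p ^ (n + r).+2 - p ^ r.+1))%N.
Proof. by rewrite cmM expcmnE !cmU. Qed.

(** This is [zmon_umon] multiplied by [umon n], with the power of [zmon n] displayed as a p-th
    power, since derivations will treat p-th powers as constants. *)
Lemma umon_zmon n :
  mmul (umon n) ((zmon n ^^ (p ^ n)) ^^ p) =
  mmul (umon n.+1) (umon n ^^ (p ^ n.+1)).
Proof.
apply/eqP/cmP => i; rewrite !cmM !expcmnE !cmM !expcmnE !cmU.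
have neq : (n.+1 == n) = false by rewrite gtn_eqF.
have [<-|_] := eqVneq n i; rewrite ?neq ?mul0n ?mul1n ?addn0 ?add0n.
  by rewrite -mulnA -expnSr mulnBl mul1n subnKC // leq_pmulr.
case: eqP; rewrite ?mul1n ?mul0n // !expnS mulnA mulnC -mulnA.
by rewrite [(p * p ^ n)%N]mulnC.
Qed.

Lemma zmon_umon n :
  zmon n ^^ (p ^ n.+1) = mmul (umon n ^^ (p ^ n.+1 - 1)) (umon n.+1).
Proof.
apply/eqP/cmP => i; rewrite !cmM !expcmnE !cmM !expcmnE !cmU mulnDl.
by rewrite -!mulnA -expnS [((_ - _) * _)%N]mulnC.
Qed.

Lemma vmon_smon n r :
  mmul (vmon n r) (smon n r ^^ p) =
  mmul (vmon n r.+1) (mmul (umon (n + r).+1) (umon (n + r).+2 ^^ (p - 1))).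
Proof.
have le2 : (p ^ r.+1 <= p ^ (n + r).+2)%N by apply: leq_pX; lia.
have le3 : (p ^ r.+1 <= p ^ (n + r).+3)%N by apply: leq_pX; lia.
have le4 : (p ^ r.+2 <= p ^ (n + r).+3)%N by apply: leq_pX; lia.
apply/eqP/cmP => i; rewrite !cmM !expcmnE !cmM !expcmnE !cmU addnS.
rewrite -!addnA; congr (_ + _)%N.
have neq : ((n + r).+2 == (n + r).+1) = false by rewrite gtn_eqF.
have neq' : ((n + r).+1 == (n + r).+2) = false by rewrite ltn_eqF.
have [<-|_] := eqVneq (n + r).+1 i; rewrite ?neq ?mul0n ?mul1n ?addn0 ?add0n.
  by rewrite -expnSr subnK.
case: eqP => _; rewrite ?mul1n ?mul0n //.
rewrite mulnBl -(expnSr p r.+1) mulnBr muln1.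
have : (p ^ (n + r).+3 <= p ^ (n + r).+3 * p)%N by rewrite leq_pmulr.
move: le4; move: (p ^ (n + r).+3)%N (p ^ r.+2)%N; clear; lia.
Qed.

Lemma cm_prod J (r : seq J) (F : J -> {cmonom nat}) j :
  (\big[mmul/mone]_(i <- r) F i) j = (\sum_(i <- r) F i j)%N.
Proof.
apply: (big_morph (fun m : {cmonom nat} => m j)) => [m1 m2|]; last exact: cm1.
exact: cmM.
Qed.

Lemma monom_deg_ord m N : (forall i, i \in finsupp m -> (i < N)%N) ->
  monom_deg p m fset0 = \sum_(i < N) x_deg p i.+1 *+ m i.
Proof.
move=> ltN; rewrite /monom_deg big_seq_fset0 addr0.
rewrite -(big_mkord xpredT (fun i => x_deg p i.+1 *+ m i)).
rewrite [RHS](bigID (mem (finsupp m))) /= [X in _ + X]big1 => [|i]; last first.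
  by rewrite -cmE_eq0 => /eqP->.
rewrite addr0 -[RHS]big_filter; apply: perm_big; apply: uniq_perm.
- exact: fset_uniq.
- exact/filter_uniq/iota_uniq.
by move=> i; rewrite mem_filter mem_index_iota andb_idr // => /ltN.
Qed.

(** The factor [vmon i (N - i.+1)] is x_(i+1) times x_(N+1) to the power p^(N+1) - p^(N-i), which is
    p^(N+1) times half the degree of x_(i+1). The exponents of x_(N+1) thus add up to p^(N+1) times
    [hdeg m]. *)
Lemma even_deg_vmon m N : even_deg m -> (forall i, i \in finsupp m -> (i < N)%N) ->
  mmul m (umon N ^^ hdeg m) =
  \big[mmul/mone]_(i < N) (vmon i (N - i.+1) ^^ m i).
Proof.
move=> em ltN; apply/eqP/cmP => j; rewrite cm_prod cmM !expcmnE cmU.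
have vE (i : 'I_N) : (vmon i (N - i.+1) ^^ m i) j =
    ((i == j :> nat) * m i + (N == j) * ((p ^ N.+1 - p ^ (N - i)) * m i))%N.
  rewrite expcmnE cmM expcmnE !cmU mulnDl -mulnA.
  by rewrite -addSn subnKC // subnSK.
rewrite (eq_bigr _ (fun i _ => vE i)) big_split /=; congr (_ + _)%N.
  have [lt_jN|le_Nj] := ltnP j N.
    rewrite (bigD1 (Ordinal lt_jN)) //= eqxx mul1n big1 ?addn0 // => i.
    by rewrite -val_eqE /= => /negbTE->.
  rewrite big1 => [|i _]; last by rewrite ltn_eqF // (leq_trans _ le_Nj).
  by apply/eqP; rewrite cmE_eq0; apply: contraTN le_Nj => /ltN; rewrite -ltnNge.
rewrite -big_distrr /= -mulnA; congr (_ * _)%N.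
apply/eqP; rewrite -(eqn_pmul2l (isT : 0 < 2)%N) -(eqr_nat rat).
rewrite mulnCA natrM -[X in _ * X]em (monom_deg_ord ltN) mulr_sumr.
rewrite big_distrr natr_sum /=; apply/eqP/eq_bigr => i _.
have le_p : (p ^ (N - i) <= p ^ N.+1)%N by apply: leq_pX; lia.
rewrite x_degE // -mulr_natr !natrM natrB //.
have -> : (p ^ N.+1 = p ^ i.+1 * p ^ (N - i))%N.
  by rewrite -expnD addSn subnKC // ltnW.
by rewrite natrM; field; exact: nz_p.
Qed.

(** For i < N, p^(i+1) divides p^N, so the p^N-th power of x_(i+1) is a power of [umon i]. *)
Lemma expX_umon m N : (forall i, i \in finsupp m -> (i < N)%N) ->
  m ^^ (p ^ N) = \big[mmul/mone]_(i < N) (umon i ^^ (m i * p ^ (N - i.+1))).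
Proof.
move=> ltN; apply/eqP/cmP => j; rewrite cm_prod expcmnE.
have uE (i : 'I_N) : (umon i ^^ (m i * p ^ (N - i.+1))) j =
    ((i == j :> nat) * (m i * p ^ N))%N.
  by rewrite !expcmnE cmU -mulnA [(p ^ i.+1 * _)%N]mulnCA -expnD subnKC.
rewrite (eq_bigr _ (fun i _ => uE i)).
have [lt_jN|le_Nj] := ltnP j N.
  rewrite (bigD1 (Ordinal lt_jN)) //= eqxx mul1n big1 ?addn0 // => i.
  by rewrite -val_eqE /= => /negbTE->.
rewrite big1 => [|i _]; last by rewrite ltn_eqF // (leq_trans _ le_Nj).
apply/eqP; rewrite muln_eq0 cmE_eq0; apply/orP; left.
by apply: contraTN le_Nj => /ltN; rewrite -ltnNge.
Qed.

End EvenMonomials.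

(** * Operations on monomials *)

Lemma poly_mul_eq (R : nzRingType) (h f g : {poly R}) (c a b : nat -> R) :
  (forall i, h`_i = c i) -> (forall i, f`_i = a i) -> (forall i, g`_i = b i) ->
  (forall r, c r = \sum_(i < r.+1) a i * b (r - i)%N) -> h = f * g.
Proof.
move=> hE fE gE cE; apply/polyP => r; rewrite hE cE coefM.
by apply: eq_bigr => i _; rewrite fE gE.
Qed.

Lemma finsupp_bound (m : {cmonom nat}) :
  exists N, forall i, i \in finsupp m -> (i < N)%N.
Proof.
exists (\max_(i <- finsupp m) i).+1 => i im; rewrite ltnS.
exact: (@leq_bigmax_seq nat _ xpredT id i im isT).
Qed.

Section SteenrodAction.
Context (p : nat) (k : fieldType) (P : nat -> Rinf k -> Rinf k).
Context (p_pr : prime p) (p_odd : odd p) (charkp : p \in [pchar k]).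
Context (actP : steenrod_action p P) (cartanP : cartan_formula p P)
        (unstableP : unstable_conditions p P).
Local Notation mon := (mon k).
Local Notation pmon := (pmon k).
Local Notation hdeg := (hdeg p).
Local Notation even_deg := (even_deg p).
Implicit Types (m a : {cmonom nat}) (S : {fset nat}).

Let p_gt0 : (0 < p)%N. Proof. exact: prime_gt0. Qed.
Let p_gt1 : (1 < p)%N. Proof. exact: prime_gt1. Qed.
Let pX_gt0 e : (0 < p ^ e)%N. Proof. by rewrite expn_gt0 p_gt0. Qed.

Lemma in_Einf_deg_mon m : even_deg m -> in_Einf_deg p (2 * hdeg m)%N%:Z (mon m).
Proof.
move=> em; split=> [|m' S /occurs_mon[-> ->]]; last exact: em.
have [N ltN] := finsupp_bound m.
by exists N; split=> m' S /occurs_mon[-> ->] //; rewrite em natr_int.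
Qed.

Lemma P_mon_top m : even_deg m -> P (hdeg m) (mon m) = mon (m ^^ p).
Proof. by move=> em; rewrite monX; apply: (unstableP _ (in_Einf_deg_mon em)).1. Qed.

Lemma P_mon_gt m i : even_deg m -> (hdeg m < i)%N -> P i (mon m) = 0.
Proof.
move=> em lt_i; apply: (unstableP _ (in_Einf_deg_mon em)).2.
by rewrite ltz_nat ltn_pmul2l.
Qed.

Lemma P_monM m1 m2 r : even_deg m1 -> even_deg m2 ->
  P r (mon (mmul m1 m2)) = \sum_(i < r.+1) P i (mon m1) * P (r - i)%N (mon m2).
Proof.
move=> e1 e2; rewrite monM.
exact: cartanP (in_Einf_deg_mon e1) (in_Einf_deg_mon e2).
Qed.

Lemma monom_deg_P m i a S : even_deg m -> occurs a S (P i (mon m)) ->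
  monom_deg p a S = (2 * hdeg m + 2 * i * (p - 1))%:R.
Proof.
move=> em aS; have [_ ->//] := actP.1 i _ _ (in_Einf_deg_mon em).
Qed.

(** * The total operation modulo the exterior generators *)

Fact total_op_exists : {f : {cmonom nat} -> {poly polyring k} |
  forall m, f m = \poly_(i < (hdeg m).+1) coefx fset0 (P i (mon m))}.
Proof. by exists (fun m => \poly_(i < (hdeg m).+1) coefx fset0 (P i (mon m))). Qed.

(** The polynomial phi(m) in s, reduced modulo the exterior generators. For [m] of even degree, the
    cut at [hdeg m] loses nothing, by the unstable condition. *)
Definition total_op := sval total_op_exists.

Lemma coef_total_op m i : even_deg m ->
  (total_op m)`_i = coefx fset0 (P i (mon m)).
Proof.
move=> em; rewrite /total_op (svalP total_op_exists m) coef_poly ltnS.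
by case: leqP => // lt_i; rewrite P_mon_gt // coefx0.
Qed.

Lemma size_total_op m : (size (total_op m) <= (hdeg m).+1)%N.
Proof. by rewrite /total_op (svalP total_op_exists m) size_poly. Qed.

Lemma coefx_P_top m : even_deg m ->
  coefx fset0 (P (hdeg m) (mon m)) = pmon (m ^^ p).
Proof. by move=> em; rewrite P_mon_top // coefx_mon0. Qed.

Lemma total_opM m1 m2 : even_deg m1 -> even_deg m2 ->
  total_op (mmul m1 m2) = total_op m1 * total_op m2.
Proof.
move=> e1 e2; have [e12 _] := even_degM e1 e2.
apply: (poly_mul_eq (fun i => coef_total_op i e12) (fun i => coef_total_op i e1)
                    (fun i => coef_total_op i e2)) => r.
rewrite P_monM // coefx_sum; apply: eq_bigr => i _; exact: coefxM_fset0.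
Qed.

Lemma total_op1 : total_op mone = 1.
Proof.
have [e1 h1] := even_deg1 p; apply/polyP => i.
rewrite coef1 coef_total_op //; case: i => [|i]; last first.
  by rewrite P_mon_gt ?h1 // coefx0.
(* As |1| = 0, the unstable condition gives P^0(1) = 1^p = 1. *)
have -> : P 0 (mon mone) = mon mone.
  by have := P_mon_top e1; rewrite h1 monX mon1 expr1n.
by rewrite coefx_mon0 pmon1.
Qed.

Lemma total_opX m n : even_deg m -> total_op (m ^^ n) = total_op m ^+ n.
Proof.
move=> em; elim: n => [|n IHn]; first by rewrite expcmn0 total_op1.
by rewrite expcmnS total_opM ?IHn ?exprS //; apply: (even_degX n em).1.
Qed.

(** The multiplicative total operation turns the relation between monomials into one between
    polynomials, to which [coef_top_pcharX] applies with t = [hdeg m1 - i]. The leading coefficients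
    are p-th powers. *)
Lemma total_op_root m1 m2 z n i :
    even_deg m1 -> even_deg m2 -> even_deg z ->
    z ^^ (p ^ n) = mmul (m1 ^^ (p ^ n - 1)) m2 ->
    (hdeg m1 < p ^ n)%N -> (hdeg m1 <= hdeg m2)%N -> (i <= hdeg m1)%N ->
  pmon (m1 ^^ p ^^ (p ^ n)) * coefx fset0 (P (hdeg m2 - (hdeg m1 - i)) (mon m2)) =
  pmon (z ^^ p ^^ (p ^ n)) * coefx fset0 (P i (mon m1)).
Proof.
move=> e1 e2 ez zE lt_m1 le_m12 le_i.
have [e1' h1'] := even_degX (p ^ n - 1) e1; have [_ hz] := even_degX (p ^ n) ez.
have eqf : total_op m1 ^+ (p ^ n - 1) * total_op m2 = total_op z ^+ (p ^ n).
  rewrite -(total_opX (p ^ n - 1) e1) -(total_opX (p ^ n) ez) zE.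
  by rewrite (total_opM e1' e2).
have hE : ((p ^ n - 1) * hdeg m1 + hdeg m2 = p ^ n * hdeg z)%N.
  by rewrite -hz zE (even_degM e1' e2).2 h1'.
have le_t : (hdeg m1 - i <= hdeg m1)%N by exact: leq_subr.
have := coef_top_pcharX (pchar_polyring charkp) (fun i => coef_total_op i e1)
  (fun i => coef_total_op i e2) (fun i => coef_total_op i ez)
  (size_total_op m1) (size_total_op m2) (size_total_op z) eqf hE
  (leq_ltn_trans le_t lt_m1) le_t (leq_trans le_t le_m12).
by rewrite (subKn le_i) (coefx_P_top e1) (coefx_P_top ez) -!(pmonX _ _ (p ^ n)).
Qed.

(* In total_op_root for umon n, umon (n+1) and zmon n, the coefficients of
   umon n are divisible by x_(n+1)^(p * p^(n+1)), so for degree reasons they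
   vanish except for the leading one. *)
Lemma coefx_P_umon n i : (i < hdeg (umon p n))%N ->
  coefx fset0 (P i (mon (umon p n))) = 0.
Proof.
move=> lt_i; have [eu hu] := even_umon p_pr n.
have [ev hv] := even_umon p_pr n.+1; have ez := even_zmon p_pr n.
have lt_u : (hdeg (umon p n) < p ^ n.+1)%N by rewrite hu subn1 ltn_predL.
have le_uv : (hdeg (umon p n) <= hdeg (umon p n.+1))%N.
  by rewrite hu hv leq_sub2r // leq_exp2l.
have eqA := total_op_root eu ev ez (zmon_umon p n) lt_u le_uv (ltnW lt_i).
apply: support_eq0 => a; apply/negP => aP.
have := support_pmonM (esym eqA) aP n.
have neq : (n.+1 == n) = false by rewrite gtn_eqF.
rewrite !(expcmnE _ (p ^ n.+1)) !(expcmnE _ p) umonE zmonE eqxx neq.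
rewrite mul0n addn0 !mul1n => le_a.
(* With q = p^(n+1), [le_a] reads q p q <= (q - 1) p q + a_n. *)
have {}le_a : (p ^ n.+1 * p <= a n)%N.
  move: (a n) (p ^ n.+1)%N (pX_gt0 n.+1) le_a => c [//|q] _.
  have -> : (q.+1 * p * q.+1 = q * p * q.+1 + q.+1 * p)%N.
    by rewrite [(q.+1 * p)%N in LHS]mulSn mulnDl addnC [(p * _)%N]mulnC.
  by rewrite subn1 leq_add2l.
(* The divisor has degree p |u_n|, but P^i(u_n) has degree |u_n| + 2i (p - 1), which is smaller
   because 2i < |u_n|. *)
have := monom_deg_ge p_pr p_odd fset0 le_a.
rewrite big_seq_fset0 addr0 (monom_deg_P eu aP) -monom_degU -monom_degX.
have -> : 'U_n ^^ (p ^ n.+1 * p) = umon p n ^^ p.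
  by apply/eqP/cmP => j; rewrite !expcmnE mulnA.
rewrite monom_degX eu -mulrnA ler_nat; move: lt_i p_gt1; clear.
by move: (hdeg _) => d; nia.
Qed.

Definition top_only m : Prop := even_deg m /\
  forall i, (i < hdeg m)%N -> coefx fset0 (P i (mon m)) = 0.

Lemma top_only1 : top_only mone.
Proof. by have [e1 h1] := even_deg1 p; split=> // i; rewrite h1. Qed.

Lemma top_onlyM m1 m2 : top_only m1 -> top_only m2 -> top_only (mmul m1 m2).
Proof.
move=> [e1 P1] [e2 P2]; have [e12 h12] := even_degM e1 e2; split=> // r.
rewrite h12 P_monM // coefx_sum => lt_r; apply: big1 => i _.
rewrite coefxM_fset0; have [lt_i|le_i] := ltnP i (hdeg m1).
  by rewrite P1 // mul0r.
rewrite P2 ?mulr0 //; have := ltn_ord i; lia.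
Qed.

Lemma top_onlyX m n : top_only m -> top_only (m ^^ n).
Proof.
move=> Tm; elim: n => [|n IHn]; first exact: top_only1.
by rewrite expcmnS; apply: top_onlyM.
Qed.

Lemma coefx_P_lower m i : even_deg m -> (i < hdeg m)%N ->
  coefx fset0 (P i (mon m)) = 0.
Proof.
move=> em lt_i; have [N ltN] := finsupp_bound m.
have [eq Pq] : top_only (m ^^ (p ^ N)).
  rewrite (expX_umon p ltN); apply: big_ind => [|m1 m2|j _].
  - exact: top_only1.
  - exact: top_onlyM.
  apply: top_onlyX; split=> [|r]; first exact: (even_umon p_pr j).1.
  exact: coefx_P_umon.
apply: (polyring_reduced (n := N) charkp).
have lt_iN : (i * p ^ N < hdeg (m ^^ (p ^ N)))%N.
  by rewrite (even_degX _ em).2 mulnC ltn_pmul2l.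
(* The coefficient of s^(i p^N) in phi(m)^(p^N) is the p^N-th power of the coefficient of s^i in
   phi(m). *)
have := coef_pcharX N (total_op m) (i * p ^ N) (pchar_polyring charkp).
rewrite (dvdn_mull _ (dvdnn _)) (mulnK _ (pX_gt0 N)) -(total_opX _ em).
by rewrite (coef_total_op _ eq) (Pq _ lt_iN) (coef_total_op _ em) => <-.
Qed.

(* P^(hdeg m - i), which is 0 for i > hdeg m rather than P^0. *)
Definition defect i m : Rinf k :=
  if (i <= hdeg m)%N then P (hdeg m - i) (mon m) else 0.

Lemma coefx_defect i m : even_deg m -> (0 < i)%N -> coefx fset0 (defect i m) = 0.
Proof.
move=> em i_gt0; rewrite /defect; case: leqP => [le_i|_]; last exact: coefx0.
by apply: coefx_P_lower => //; lia.
Qed.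

Lemma monom_deg_defect i m a S : even_deg m -> occurs a S (defect i m) ->
  (i <= hdeg m)%N /\
  monom_deg p a S = (2 * hdeg m + 2 * (hdeg m - i) * (p - 1))%:R.
Proof.
rewrite /defect => em; case: leqP => [le_i|_] aS.
  by split; last exact: monom_deg_P em aS.
by move: aS; rewrite /occurs mcoeff0 msupp0 in_fset0.
Qed.

Lemma sum_ord_if (V : nmodType) (x : V) n c :
  \sum_(a < n) (if val a == c then x else 0) = if (c < n)%N then x else 0.
Proof.
rewrite -big_mkcond /=; case: ltnP => [lt_cn|le_nc].
  by rewrite (big_pred1 (Ordinal lt_cn)) // => a; rewrite -val_eqE.
rewrite big1 // => a /eqP a_c; have := ltn_ord a; rewrite a_c => /leq_trans.
by move=> /(_ _ le_nc); rewrite ltnn.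
Qed.

(* If all smaller defects vanish, the defect is a derivation along the
   Frobenius map. *)
Section Derivation.
Context (i : nat) (i_gt0 : (0 < i)%N).
Context (defect_lt : forall j m, (0 < j < i)%N -> even_deg m -> defect j m = 0).

Lemma defectM m1 m2 : even_deg m1 -> even_deg m2 ->
  defect i (mmul m1 m2) =
    mon (m1 ^^ p) * defect i m2 + defect i m1 * mon (m2 ^^ p).
Proof.
move=> e1 e2; have [e12 h12] := even_degM e1 e2.
have defect_gt m : (hdeg m < i)%N -> defect i m = 0.
  by rewrite /defect ltnNge => /negbTE->.
rewrite {1}/defect h12; case: leqP => [le_i|lt_i]; last first.
  by rewrite !defect_gt ?mulr0 ?mul0r ?addr0 //; lia.
set X := mon _ * _; set Y := _ * mon _.
rewrite P_monM //.
(* The term at [a] pairs the defects of index j = [hdeg m1 - a] and i - j. For 0 < j < i the first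
   vanishes by assumption; a negative index on either side exceeds the top degree. Only j = 0 and j
   = i remain, giving [X] and [Y]. *)
have termE (a : 'I_(hdeg m1 + hdeg m2 - i).+1) :
    P a (mon m1) * P (hdeg m1 + hdeg m2 - i - a)%N (mon m2) =
    (if val a == hdeg m1 then X else 0) +
    (if val a == (hdeg m1 - i)%N then if (i <= hdeg m1)%N then Y else 0 else 0).
  have := ltn_ord a; rewrite ltnS /=; move: (nat_of_ord a) => {}a le_a.
  have [lt_a|gt_a|eq_a] := ltngtP a (hdeg m1).
  - rewrite add0r; have [lt_ai|gt_ai|eq_ai] := ltngtP (hdeg m1 - a) i.
    + have := @defect_lt (hdeg m1 - a)%N m1 _ e1.
      rewrite /defect leq_subr subKn ?(ltnW lt_a) // => ->; last by lia.
      rewrite mul0r; case: leqP => [le_i1|_]; last by rewrite if_same.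
      by rewrite ifF //; apply/eqP; lia.
    + rewrite [P _ (mon m2)]P_mon_gt ?mulr0 //; last by lia.
      by rewrite ifF //; apply/eqP; lia.
    have -> : a = (hdeg m1 - i)%N by lia.
    have le_i1 : (i <= hdeg m1)%N by lia.
    rewrite eqxx le_i1 /Y /defect le_i1.
    have -> : (hdeg m1 + hdeg m2 - i - (hdeg m1 - i))%N = hdeg m2 by lia.
    by rewrite P_mon_top.
  - rewrite P_mon_gt // mul0r gtn_eqF ?addr0 //; lia.
  rewrite {a}eq_a in le_a *; rewrite [X in _ + X](_ : _ = 0); last first.
    case: leqP => [le_i1|_]; last by rewrite if_same.
    by rewrite ifF //; apply/eqP; lia.
  rewrite addr0 /X /defect (P_mon_top e1).
  have -> : (i <= hdeg m2)%N by lia.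
  by have -> : (hdeg m1 + hdeg m2 - i - hdeg m1)%N = (hdeg m2 - i)%N by lia.
rewrite (eq_bigr _ (fun j _ => termE j)) big_split /= !sum_ord_if; congr (_ + _).
  case: ltnP => // le_1; rewrite /X defect_gt ?mulr0 //; lia.
have -> : (hdeg m1 - i < (hdeg m1 + hdeg m2 - i).+1)%N by lia.
by case: leqP => // lt_1; rewrite /Y defect_gt ?mul0r.
Qed.

Lemma coefx_defectM S m1 m2 : even_deg m1 -> even_deg m2 ->
  coefx S (defect i (mmul m1 m2)) =
    pmon (m1 ^^ p) * coefx S (defect i m2) + pmon (m2 ^^ p) * coefx S (defect i m1).
Proof.
move=> e1 e2; rewrite (defectM e1 e2) coefxD.
by congr (_ + _); [exact: coefx_monl | exact: coefx_monr].
Qed.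

(** * Monomials killed by the derivation *)

Definition null m : Prop := even_deg m /\ defect i m = 0.

Lemma null1 : null mone.
Proof.
have [e1 h1] := even_deg1 p; split=> //.
by rewrite /defect h1 leqNgt i_gt0.
Qed.

Lemma nullM m1 m2 : null m1 -> null m2 -> null (mmul m1 m2).
Proof.
move=> [e1 d1] [e2 d2]; split; first exact: (even_degM e1 e2).1.
by rewrite (defectM e1 e2) d1 d2 mulr0 mul0r addr0.
Qed.

Lemma coefx_defect_null S m1 m2 : even_deg m1 -> null m2 ->
  coefx S (defect i (mmul m1 m2)) = pmon (m2 ^^ p) * coefx S (defect i m1).
Proof.
move=> e1 [e2 d2]; rewrite (defectM e1 e2) d2 mulr0 add0r; exact: coefx_monr.
Qed.

Lemma nullX m n : null m -> null (m ^^ n).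
Proof.
move=> nm; elim: n => [|n IHn]; first exact: null1.
by rewrite expcmnS; apply: nullM.
Qed.

(** The power rule D(m^(n+1)) = (n+1) m^(pn) D(m), taken at n + 1 = p. *)
Lemma nullXp m : even_deg m -> null (m ^^ p).
Proof.
move=> em; split; first exact: (even_degX p em).1.
have powE S n : coefx S (defect i (m ^^ n.+1)) =
    pmon (m ^^ p ^^ n) * coefx S (defect i m) *+ n.+1.
  elim: n => [|n IHn].
    by rewrite expcmnS !expcmn0 mulm1 pmon1 mul1r.
  rewrite expcmnS (coefx_defectM S em (even_degX n.+1 em).1).
  have -> : m ^^ n.+1 ^^ p = m ^^ p ^^ n.+1.
    by apply/eqP/cmP => j; rewrite !expcmnE mulnAC.
  by rewrite IHn mulrnAr mulrA -pmonM -expcmnS [RHS]mulrSr.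
apply: coefx_eq0 => S; rewrite -(prednK p_gt0) powE prednK //.
exact: (mulrn_pchar (pchar_polyring charkp)).
Qed.

(* The logarithmic derivatives defect i x / x^p and defect i y / y^p agree,
   because those of p-th powers and of null monomials vanish. *)
Lemma support_defect x s y v a S :
    even_deg x -> even_deg s -> even_deg y -> null v ->
    mmul x (s ^^ p) = mmul y v -> a \in support (coefx S (defect i x)) ->
  forall j, (p * x j <= a j + p * y j)%N.
Proof.
move=> ex es ey nv eq_xy aS j.
have eqD : pmon (s ^^ p ^^ p) * coefx S (defect i x) =
           pmon (v ^^ p) * coefx S (defect i y).
  rewrite -(coefx_defect_null S ex (nullXp es)) -(coefx_defect_null S ey nv).
  by rewrite eq_xy.
have := support_pmonM eqD aS j; move/eqP/cmP/(_ j): eq_xy.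
rewrite !cmM !expcmnE; move: (x j) (s j) (y j) (v j) (a j); clear.
by move=> x s y v a; nia.
Qed.

(** In [umon_zmon] the comparison monomial [umon n.+1] does not involve x_(n+1), so every monomial
    of the defect is divisible by u_n^p. That already has degree p |u_n|, while the defect has
    degree p |u_n| - 2i (p - 1). *)
Lemma null_umon n : null (umon p n).
Proof.
have [eu hu] := even_umon p_pr n; have [ev _] := even_umon p_pr n.+1.
have ez := even_zmon p_pr n; split=> //.
have nv := nullXp (even_degX (p ^ n) eu).1.
have rel : mmul (umon p n) (zmon p n ^^ (p ^ n) ^^ p) =
           mmul (umon p n.+1) (umon p n ^^ (p ^ n) ^^ p).
  rewrite umon_zmon //; congr mmul.
  by apply/eqP/cmP => j; rewrite !expcmnE expnSr mulnA.
apply: coefx_eq0 => S; apply: support_eq0 => a; apply/negP => aS.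
have := support_defect eu (even_degX (p ^ n) ez).1 ev nv rel aS n.
rewrite !umonE eqxx (gtn_eqF (ltnSn n)) mul0n muln0 addn0 mul1n => le_a.
have [le_i degE] := monom_deg_defect eu aS.
have := monom_deg_ge p_pr p_odd S le_a.
rewrite degE -monom_degU -monom_degX.
have -> : 'U_n ^^ (p * p ^ n.+1) = umon p n ^^ p.
  by apply/eqP/cmP => j; rewrite !expcmnE mulnA mulnAC.
rewrite monom_degX eu -mulrnA; apply/negP; rewrite -ltNge.
apply: (@lt_le_trans _ _ (2 * hdeg (umon p n) * p)%:R); last first.
  by rewrite lerDl sumr_ge0 // => j _; rewrite ltW // xi_degS_gt0.
rewrite ltr_nat; move: le_i i_gt0 p_gt1; clear.
by move: (hdeg _) => d; nia.
Qed.

Lemma null_vmon n r : null (vmon p n r).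
Proof.
have [ev hv] := even_vmon p_pr n r; have [ev' _] := even_vmon p_pr n r.+1.
have es := even_smon p_pr n r; split=> //.
have nu : null (mmul (umon p (n + r).+1) (umon p (n + r).+2 ^^ (p - 1))).
  by apply: nullM (null_umon _) _; apply: nullX (null_umon _).
apply: coefx_eq0 => S; apply: support_eq0 => a; apply/negP => aS.
(* The variable x_(n+r+2) does not occur in [vmon p n r.+1], and its exponent in [vmon p n r] equals
   [hdeg (vmon p n r)]. *)
have := support_defect ev es ev' nu (vmon_smon p_pr n r) aS (n + r).+1.
have neq : (n == (n + r).+1) = false by rewrite ltn_eqF // ltnS leq_addr.
have neq' : ((n + r.+1).+1 == (n + r).+1) = false.
  by rewrite addnS gtn_eqF.
rewrite !vmonE eqxx neq neq' mul0n muln0 addn0 add0n mul1n -hv => le_a.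
have [le_i degE] := monom_deg_defect ev aS.
(* [S] is nonempty because the part without exterior generators vanishes. As p - 1 divides
   [hdeg (vmon p n r)], the degree is a multiple of 2 (p - 1), hence so is the size of [S], which is
   therefore at least 4. *)
have S_gt3 : (3 < #|` S|)%N.
  have S_neq0 : S != fset0.
    apply: contraTneq aS => ->.
    by rewrite (coefx_defect ev i_gt0) /support msupp0 in_fset0.
  have [c dE] : exists c, (hdeg (vmon p n r) = (p - 1) * c)%N.
    exists (p ^ r.+1 * ((p ^ n.+1 - 1) %/ (p - 1)))%N.
    have dvd1 : (p - 1 %| p ^ n.+1 - 1)%N.
      by rewrite -{2}(exp1n n.+1) subn_exp dvdn_mulr.
    rewrite mulnCA [((p - 1) * _)%N]mulnC divnK // mulnBr muln1 -expnD hv.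
    by rewrite addnC addSn addnS.
  have := @dvdn_card_exterior p p_pr p_odd a S (c + (hdeg (vmon p n r) - i)).
  rewrite degE => /(_ _)/dvdn_leq.
  have -> : (2 * hdeg (vmon p n r) + 2 * (hdeg (vmon p n r) - i) * (p - 1) =
             2 * (p - 1) * (c + (hdeg (vmon p n r) - i)))%N.
    rewrite [RHS]mulnDr -[(2 * (p - 1) * c)%N]mulnA -dE.
    by rewrite [(2 * (p - 1) * _)%N]mulnAC.
  rewrite cardfs_gt0 S_neq0 => /(_ isT erefl); apply: leq_trans.
  by rewrite mulnBr; lia.
have := monom_deg_ge p_pr p_odd S le_a; rewrite degE x_degE //.
have := sum_xi_deg_gt2 p_pr p_odd S_gt3; move: (\sum_(j <- S) _) => x x_gt2.
set h := hdeg _ in hv le_a le_i degE *.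
(* This bounds the degree of x_(n+r+2)^(ph) below by 2ph - 2p. With the exterior part the total
   exceeds 2ph - 2p + 2, whereas the defect has degree 2ph - 2i (p - 1), at most 2ph - 2p + 2. *)
have h_le : 2 / (p ^ (n + r).+2)%:R * (h%:R) <= 2 :> rat.
  rewrite mulrAC ler_pdivrMr ?ltr0n ?pX_gt0 // ler_pM2l // ler_nat.
  by rewrite hv leq_subr.
rewrite -[_ *+ _]mulr_natr natrM.
move: (2 / _) h_le => q h_le; apply/negP; rewrite -ltNge.
have : ((2 - q) * (p%:R * h%:R) + x = 2 * (p%:R * h%:R) - p%:R * (q * h%:R) + x).
  by ring.
move=> ->.
have hp : p%:R * (q * h%:R) <= p%:R * 2 :> rat by rewrite ler_wpM2l ?ler0n.
have hn : (2 * h + 2 * (h - i) * (p - 1) + 2 * p <= 2 * (p * h) + 2)%N.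
  by move: le_i i_gt0 p_gt1; clear; nia.
have : ((2 * h + 2 * (h - i) * (p - 1) + 2 * p)%:R <= (2 * (p * h) + 2)%:R :> rat).
  by rewrite ler_nat.
rewrite ![(_ + 2 * p)%:R]natrD ![(_ + 2)%:R]natrD !(natrM _ 2) natrM.
lra.
Qed.

(** By [even_deg_vmon], [m] times a power of [umon p N] is a product of null monomials. As
    [umon p N] is null itself, it only contributes a monomial factor, which cancels. *)
Lemma null_even_deg m : even_deg m -> null m.
Proof.
move=> em; have [N ltN] := finsupp_bound m; split=> //.
have [_ d0] : null (mmul m (umon p N ^^ hdeg m)).
  rewrite (even_deg_vmon p_pr em ltN); apply: big_ind => [|m1 m2|j _].
  - exact: null1.
  - exact: nullM.
  exact/nullX/null_vmon.
apply: coefx_eq0 => S; apply: (@pmon_mulI k (umon p N ^^ hdeg m ^^ p)).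
rewrite -(coefx_defect_null S em (nullX (hdeg m) (null_umon N))) d0 mulr0.
exact: coefx0.
Qed.

End Derivation.

(** * Vanishing of all positive defects *)

Lemma defect_eq0 i m : (0 < i)%N -> even_deg m -> defect i m = 0.
Proof.
elim/ltn_ind: i m => i IH m i_gt0 em.
have lt_eq0 j m' : (0 < j < i)%N -> even_deg m' -> defect j m' = 0.
  by case/andP=> j_gt0 lt_ji; apply: IH.
exact: (null_even_deg i_gt0 lt_eq0 em).2.
Qed.

Lemma P_mon_eq0 i m : even_deg m -> i <> hdeg m -> P i (mon m) = 0.
Proof.
move=> em neq_i; have [lt_i|gt_i|//] := ltngtP i (hdeg m); last exact: P_mon_gt.
have := @defect_eq0 (hdeg m - i)%N m.
by rewrite /defect leq_subr (subKn (ltnW lt_i)) subn_gt0; apply.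
Qed.

End SteenrodAction.

(** * Homogeneous elements *)

Section HomogeneousElements.
Context (p : nat) (k : fieldType).
Implicit Types (x y : Rinf k) (m a : {cmonom nat}).

Lemma in_Einf_deg0 d : in_Einf_deg p d (0 : Rinf k).
Proof.
have occ0 m S : ~ occurs m S (0 : Rinf k).
  by rewrite /occurs mcoeff0 msupp0 in_fset0.
by split=> [|m S /occ0]; first by exists 0%N; split=> m S /occ0.
Qed.

Lemma in_Einf_degD d x y :
  in_Einf_deg p d x -> in_Einf_deg p d y -> in_Einf_deg p d (x + y).
Proof.
move=> [[n1 [R1 E1]] hx] [[n2 [R2 E2]] hy]; split; last first.
  by move=> m S /occursD[/hx|/hy].
exists (maxn n1 n2).
split=> m S /occursD[] occ; try by [exact: E1 occ | exact: E2 occ].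
- by have [b1 b2] := R1 _ _ occ; split=> i => [/b1|/b2]; rewrite leq_max => ->.
by have [b1 b2] := R2 _ _ occ; split=> i => [/b1|/b2]; rewrite leq_max orbC => ->.
Qed.

Definition term (c : k) m : Rinf k := << << c *g m >> *g fset0 >>.

Lemma occurs_term c m a S : occurs a S (term c m) -> a = m /\ S = fset0.
Proof.
rewrite /occurs /term mcoeffU; case: eqP => [<-|_]; last first.
  by rewrite mulr0n msupp0 in_fset0.
by rewrite mulr1n => /(fsubsetP msuppU_le); rewrite in_fset1 => /eqP.
Qed.

Lemma in_Einf_deg_term c m d :
  monom_deg p m fset0 = d%:~R -> in_Einf_deg p d (term c m).
Proof.
move=> degE; split=> [|a S /occurs_term[-> ->] //].
have [N ltN] := finsupp_bound m.
by exists N; split=> a S /occurs_term[-> ->] //; rewrite degE intr_int.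
Qed.

(** The operations are only assumed additive, so a scalar is split off as a factor of degree 0 to
    which the Cartan formula applies. *)
Lemma termE c m : term c m = term c mone * mon k m.
Proof.
rewrite monE /term -constM; congr (<< _ *g fset0 >>).
by rewrite malgM_def fgmulUU mulr1 mul1m.
Qed.

Lemma poly_sum_terms x : (forall m S, occurs m S x -> S = fset0) ->
  x = \sum_(a <- msupp x@_fset0) term (x@_fset0)@_a a.
Proof.
move=> x_poly; apply/malgP => S; rewrite raddf_sum /=.
rewrite (eq_bigr (fun a => << (x@_fset0)@_a *g a >> *+ (fset0 == S))); last first.
  by move=> a _; exact: mcoeffU.
case: eqP => [<-|nz_S]; first exact: monalgE.
rewrite big1 //; apply/malgP => a; rewrite mcoeff0; apply/eqP.
by rewrite mcoeff_eq0; apply/negP => /x_poly; apply: nesym.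
Qed.

End HomogeneousElements.

Theorem theorem5p2 (p : nat) (k : fieldType) (P : nat -> Rinf k -> Rinf k) :
  prime p -> odd p -> p \in [pchar k]%R ->
  steenrod_action p P -> cartan_formula p P -> unstable_conditions p P ->
  forall (m : nat) (x : Rinf k),
    in_Einf_poly p x -> in_Einf_deg p (Posz (2 * m)) x ->
    P m x = (x ^+ p)%R /\ (forall i : nat, i <> m -> P i x = 0%R).
Proof.
move=> p_pr p_odd charkp actP cartanP unstableP m x [_ x_poly] deg_x.
split; first exact: (unstableP _ _ _ deg_x).1.
move=> i neq_im; rewrite (poly_sum_terms x_poly) big_seq.
have deg1 (c : k) : in_Einf_deg p 0 (term c mone).
  exact/in_Einf_deg_term/monom_deg1.
(* Additivity is available only within one degree, so homogeneity is carried along with the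
   vanishing. *)
set K := fun y => in_Einf_deg p (2 * m)%N y /\ P i y = 0.
suff [] : K (\sum_(a <- msupp x@_fset0 | a \in msupp x@_fset0)
               term (x@_fset0)@_a a) by [].
apply: (big_ind K) => [|y z [Ey Py] [Ez Pz]|a ax].
- split; first exact: in_Einf_deg0.
  have := actP.2 i _ _ _ (in_Einf_deg0 p k 0) (in_Einf_deg0 p k 0).
  by rewrite addr0 -[LHS]addr0 => /addrI.
- by split; [exact: in_Einf_degD | rewrite (actP.2 i _ _ _ Ey Ez) Py Pz addr0].
have deg_a : monom_deg p a fset0 = (2 * m)%:R by exact: deg_x.2.
have [ea ha] := hdegP deg_a; split; first exact: in_Einf_deg_term.
have Ea := in_Einf_deg_mon k ea.
have Pa : P i (mon k a) = 0.
  by apply: (P_mon_eq0 p_pr p_odd charkp actP cartanP unstableP ea); rewrite ha.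
have Pc j c : P j.+1 (term c mone) = 0 by exact: (unstableP _ _ _ (deg1 c)).2.
(* The Cartan term with P^0 on the scalar contains P^i of the monomial, which is 0; the others
   contain a positive operation on degree 0. *)
rewrite termE (cartanP i _ _ _ _ (deg1 _) Ea); apply: big1 => [[[|j] lt_j]] _ /=.
  by rewrite subn0 Pa mulr0.
by rewrite Pc mul0r.
Qed.
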